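(* For every positive integer $d$, every $\alpha\in[1,2]$ and every $\sigma>0$ there is a constant $c(d,\alpha,\sigma)>0$, depending only on $d,\alpha,\sigma$, such that the following holds. Let $$\gamma(\alpha,d)=\frac12+\frac{(d-1)(2-\alpha)}{2\alpha}.$$ If $n$ is a positive integer and $\sigma n^{-2}<\delta<1$, then $$\lambda_n(B^d_\alpha,(1-\delta,0,\dots,0))\le c(d,\alpha,\sigma)\,n^{-d}\,\delta^{\gamma(\alpha,d)}.$$
   Context: $B^d_\alpha:=\{(x_1,\dots,x_d)\in\mathbb{R}^d:|x_1|^\alpha+\dots+|x_d|^\alpha\le1\}$. Let $\mathcal{P}_{n,d}$ be the space of all real algebraic polynomials of total degree $\le n$ in $d$ variables. For a compact set $D\subset\mathbb{R}^d$ with non-empty interior, the Christoffel function (with uniform weight) is $\lambda_n(D,\boldsymbol{x})=\left(\sum_{k=1}^N\varphi_k(\boldsymbol{x})^2\right)^{-1}$, $\boldsymbol{x}\in D$, where $\{\varphi_k\}_{k=1}^N$ is an orthonormal basis of $\mathcal{P}_{n,d}$ with respect to $\langle f,g\rangle=\int_D f(\boldsymbol{y})g(\boldsymbol{y})\,d\boldsymbol{y}$. Equivalently, $\lambda_n(D,\boldsymbol{x})=\min\{\int_D f^2(\boldsymbol{y})\,d\boldsymbol{y}: f\in\mathcal{P}_{n,d},\ |f(\boldsymbol{x})|=1\}$. *)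

(* Defs.v *)
From HB Require Import structures.
From mathcomp Require Import all_boot all_order all_algebra.
(* Some notations and names of mpoly clash with those of the analysis library,
   which is imported last to take precedence. *)
From mathcomp Require Import -(notations) mpoly.
From mathcomp Require Import all_classical all_reals all_analysis.

Set Implicit Arguments.
Unset Strict Implicit.
Unset Printing Implicit Defensive.

Import Order.TTheory GRing.Theory Num.Theory.
Import numFieldNormedType.Exports.

Local Open Scope classical_set_scope.
Local Open Scope ring_scope.

(* The measurable structure on tuples is the product of the Borel
   sigma-algebras of the factors. *)
Notation Rn R d := (d.-tuple (measurableTypeR R)).

Definition Rn_cons (R : realType) (d : nat)
    (p : measurableTypeR R * Rn R d) : Rn R d.+1 := [tuple of p.1 :: p.2].

Definition Rn_uncons (R : realType) (d : nat)
    (x : Rn R d.+1) : measurableTypeR R * Rn R d :=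
  (thead x, [tuple of behead x]).

Lemma Rn_consK (R : realType) (d : nat) :
  cancel (@Rn_cons R d) (@Rn_uncons R d).
Proof. by move=> [x t]; congr pair; apply/val_inj. Qed.

Lemma Rn_unconsK (R : realType) (d : nat) :
  cancel (@Rn_uncons R d) (@Rn_cons R d).
Proof. by move=> x; rewrite [RHS]tuple_eta. Qed.

Lemma measurable_Rn_cons (R : realType) (d : nat) :
  measurable_fun setT (@Rn_cons R d).
Proof. exact: measurable_cons. Qed.

Lemma measurable_Rn_uncons (R : realType) (d : nat) :
  measurable_fun setT (@Rn_uncons R d).
Proof.
apply/measurable_fun_pairP; split; first exact: measurable_tnth.
exact: measurable_behead.
Qed.

Section lebesgue_cons.
Variables (R : realType) (d : nat).
Variable mu : {sigma_finite_measure set (Rn R d) -> \bar R}.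

Definition lebesgue_cons : set (Rn R d.+1) -> \bar R :=
  pushforward (@lebesgue_measure R \x mu)%E (@Rn_cons R d).

Let lebesgue_cons0 : lebesgue_cons set0 = 0%E.
Proof. by rewrite /lebesgue_cons/pushforward preimage_set0 measure0. Qed.

Let lebesgue_cons_ge0 A : (0 <= lebesgue_cons A)%E.
Proof. by rewrite /lebesgue_cons/pushforward measure_ge0. Qed.

Let lebesgue_cons_sigma_additive : semi_sigma_additive lebesgue_cons.
Proof. have mc := @measurable_Rn_cons R d; exact: measure_semi_sigma_additive. Qed.

HB.instance Definition _ := isMeasure.Build _ _ _ lebesgue_cons
  lebesgue_cons0 lebesgue_cons_ge0 lebesgue_cons_sigma_additive.

Let lebesgue_cons_sigma_finite : sigma_finite setT lebesgue_cons.
Proof.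
have /sigma_finiteP[F [TF ndF Foo]] := sigma_finiteT (@lebesgue_measure R).
have /sigma_finiteP[G [TG ndG Goo]] := sigma_finiteT mu.
exists (fun k => @Rn_uncons R d @^-1` (F k `*` G k)).
  rewrite -preimage_bigcup -[LHS](preimage_setT (@Rn_uncons R d)).
  congr (_ @^-1` _); rewrite -setXTT TF TG predeqE => -[x y]; split.
    move=> [/= [n _ Fnx] [k _ Gky]]; exists (maxn n k) => //; split.
    - by move: x Fnx; exact/subsetPset/ndF/leq_maxl.
    - by move: y Gky; exact/subsetPset/ndG/leq_maxr.
  by move=> [n _ []/= ? ?]; split; exists n.
move=> k; have [mF Fk] := Foo k; have [mG Gk] := Goo k; split.
  rewrite -[X in measurable X]setTI; apply: measurable_Rn_uncons => //.
  exact: measurableX.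
rewrite /lebesgue_cons/pushforward -comp_preimage.
rewrite (_ : _ \o _ = id) ?preimage_id; last exact/funext/Rn_consK.
by rewrite product_measure1E// lte_mul_pinfty// ge0_fin_numE.
Qed.

HB.instance Definition _ := Measure_isSigmaFinite.Build _ _ _ lebesgue_cons
  lebesgue_cons_sigma_finite.

End lebesgue_cons.

Fixpoint lebesgue_Rn (R : realType) (d : nat) :
    {sigma_finite_measure set (Rn R d) -> \bar R} :=
  if d is d'.+1 then lebesgue_cons (lebesgue_Rn R d') else \d_[tuple].

Lemma lebesgue_Rn_box (R : realType) (d : nat)
    (A : 'I_d -> set (measurableTypeR R)) :
  (forall i, measurable (A i)) ->
  lebesgue_Rn R d [set x | forall i, A i (tnth x i)] =
  (\prod_(i < d) lebesgue_measure (A i))%E.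
Proof.
elim: d A => [|d IHd] A mA /=.
  by rewrite big_ord0 diracE mem_set// => -[].
have mB : measurable [set x : Rn R d | forall i, A (lift ord0 i) (tnth x i)].
  rewrite [X in measurable X](_ : _ = \bigcap_(i in [set: 'I_d])
      ((fun x : Rn R d => tnth x i) @^-1` A (lift ord0 i))); last first.
    by apply/seteqP; split=> x /= Ax i; [move=> _|]; apply: Ax.
  apply: fin_bigcap_measurable => // i _.
  by rewrite -[X in measurable X]setTI; exact: measurable_tnth.
rewrite big_ord_recl -IHd// -product_measure1E//.
rewrite /lebesgue_cons /pushforward; congr (_ _).
apply/seteqP; split=> -[x t] /=.
  move=> Axt; split; first exact: (Axt ord0).
  by move=> i; have := Axt (lift ord0 i); rewrite tnthS.
move=> [Ax At] i; case: (unliftP ord0 i) => [j|] ->; last exact: Ax.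
by rewrite tnthS; exact: At.
Qed.

Section christoffel.
Variables (R : realType) (d : nat).

Local Notation poly := (mpoly d R).

Definition peval (p : poly) (x : Rn R d) : R := meval (tnth x) p.

(* [mmeasure mdeg p] (msize p in mpoly) is 1 + the total degree of p, and 0
   for p = 0. *)
Definition polys_le (n : nat) : set poly := [set p | (mmeasure mdeg p <= n.+1)%N].

Definition inner (D : set (Rn R d)) (f g : poly) : R :=
  \int[lebesgue_Rn R d]_(y in D) (peval f y * peval g y).

Definition orthonormal_basis (n : nat) (D : set (Rn R d)) (N : nat)
    (phi : 'I_N -> poly) : Prop :=
  [/\ forall k, polys_le n (phi k),
      forall p, polys_le n p ->
        exists! c : 'rV[R]_N, p = \sum_(k < N) c 0 k *: phi k &
      forall j k, inner D (phi j) (phi k) = (j == k)%:R].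

(* The Christoffel function with uniform weight: the value does not depend on
   the orthonormal basis, so [get] selects the unique element of a singleton
   when D is compact with non-empty interior. *)
Definition christoffel (n : nat) (D : set (Rn R d)) (x : Rn R d) : R :=
  get [set l : R | exists (N : nat) (phi : 'I_N -> poly),
    orthonormal_basis n D phi /\ l = (\sum_(k < N) peval (phi k) x ^+ 2)^-1].

End christoffel.

Definition lball (R : realType) (d : nat) (alpha : R) : set (Rn R d) :=
  [set x | \sum_(i < d) `|tnth x i| `^ alpha <= 1].
Arguments lball {R} d alpha.

Definition axis_point (R : realType) (d : nat) (t : R) : Rn R d :=
  [tuple if i == 0%N :> nat then t else 0 | i < d].
Arguments axis_point {R} d t.

Definition gamma_exponent (R : realType) (alpha : R) (d : nat) : R :=
  2^-1 + (d%:R - 1) * (2 - alpha) / (2 * alpha).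

(* Main.v *)
Require Import Defs.
From mathcomp Require Import all_boot all_order all_algebra.
From mathcomp Require Import ring lra.
From mathcomp Require Import -(notations) mpoly.
From mathcomp Require Import all_classical all_reals all_analysis.
From mathcomp Require Import measurable_realfun.

(* By Cauchy-Schwarz the Christoffel function at [x] is at most the integral
   of [f ^ 2] for any polynomial [f] with [f x = 1].  Writing
   [b = delta ^ (1 - 1 / alpha) / 2], Young's inequality gives
   [|x_0 + b x_i| <= 1 + delta] on the ball, so the [d] linear forms
   [x_0 / (1 + delta)] and [(x_0 + b x_i) / (1 + delta)] map the ball into
   [-1, 1] and all take the value [y = (1 - delta) / (1 + delta)] at the given
   point.  Take for [f] the product over these forms [L] of [(q L / q y) ^ 2],
   where [q t] is the Christoffel-Darboux kernel [1 + 2 sum_k T_k t * T_k y] of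
   the Chebyshev polynomials, of degree about [n / 2d].  The Darboux formula
   gives [(q t / q y) ^ 4 <= K / (1 + ((t - y) / h) ^ 2)] on [-1, 1] with [h] of
   order [sqrt delta / n].  In the coordinates [L] the integral of the product
   of these bounds is at most [(K pi h) ^ d], up to the Jacobian, which is of
   order [b ^ -(d - 1)]. *)

Set Implicit Arguments.
Unset Strict Implicit.
Unset Printing Implicit Defensive.

Import Order.TTheory GRing.Theory Num.Theory.
Import numFieldNormedType.Exports.
Local Open Scope classical_set_scope.
Local Open Scope ring_scope.

(** * Chebyshev kernel *)

(* The pair of the Chebyshev polynomials [T_k] of the first kind and [U_(k-1)] of
   the second kind at [x]; on [x = cos t] it is [(cos (k t), sin (k t) / sin t)]. *)
Fixpoint chebyshev (A : comNzRingType) (x : A) (k : nat) : A * A :=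
  if k is k'.+1 then
    let: (t, v) := chebyshev x k' in (x * t - (1 - x ^+ 2) * v, x * v + t)
  else (1, 0).

Notation chebT x k := (chebyshev x k).1.
Notation chebV x k := (chebyshev x k).2.

Lemma chebTS (A : comNzRingType) (x : A) k :
  chebT x k.+1 = x * chebT x k - (1 - x ^+ 2) * chebV x k.
Proof. by rewrite /=; case: (chebyshev x k). Qed.

Lemma chebVS (A : comNzRingType) (x : A) k :
  chebV x k.+1 = x * chebV x k + chebT x k.
Proof. by rewrite /=; case: (chebyshev x k). Qed.

Lemma chebTSS (A : comNzRingType) (x : A) k :
  chebT x k.+2 = 2 * x * chebT x k.+1 - chebT x k.
Proof. by rewrite chebTS chebVS chebTS; ring. Qed.

Lemma chebT_pell (A : comNzRingType) (x : A) k :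
  chebT x k ^+ 2 + (1 - x ^+ 2) * chebV x k ^+ 2 = 1.
Proof.
elim: k => [/=|k IHk]; first by ring.
by rewrite chebTS chebVS -[RHS]IHk; ring.
Qed.

Lemma chebD (A : comNzRingType) (x : A) j k :
  chebT x (j + k) = chebT x j * chebT x k - (1 - x ^+ 2) * (chebV x j * chebV x k)
  /\ chebV x (j + k) = chebV x j * chebT x k + chebT x j * chebV x k.
Proof.
elim: j => [|j [IHT IHV]]; first by rewrite add0n /=; split; ring.
by rewrite addSn !chebTS !chebVS IHT IHV; split; ring.
Qed.

Lemma chebT_double (A : comNzRingType) (x : A) k :
  chebT x k.*2 = 2 * chebT x k ^+ 2 - 1.
Proof.
rewrite -addnn; have [-> _] := chebD x k k.
by rewrite -[X in _ = _ - X](chebT_pell x k); ring.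
Qed.

Lemma rmorph_chebyshev (A B : comNzRingType) (f : {rmorphism A -> B}) (x : A) k :
  chebyshev (f x) k = (f (chebT x k), f (chebV x k)).
Proof.
elim: k => [|k IHk]; first by rewrite /= rmorph1 rmorph0.
rewrite [LHS]/= IHk chebTS chebVS.
by rewrite !(rmorphB, rmorphD, rmorphM, rmorph1, rmorphXn).
Qed.

(** Kept over an arbitrary commutative ring: the same expression serves at real arguments and, with
    a linear form for [x] and a constant for [y], as a polynomial in several variables. *)
Definition cheb_kernel (A : comNzRingType) (N : nat) (x y : A) : A :=
  1 + 2 * \sum_(k < N) chebT x k.+1 * chebT y k.+1.

Lemma rmorph_cheb_kernel (A B : comNzRingType) (f : {rmorphism A -> B}) N (x y : A) :
  f (cheb_kernel N x y) = cheb_kernel N (f x) (f y).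
Proof.
rewrite /cheb_kernel rmorphD rmorph1 rmorphM rmorph_nat rmorph_sum.
congr (_ + _ * _); apply: eq_bigr => k _.
by rewrite rmorphM !rmorph_chebyshev.
Qed.

(** The recurrence [chebTSS] turns the new term, times [x - y], into the increment of the right-hand
    side, so the sum telescopes. *)
Lemma cheb_kernel_darboux (A : comNzRingType) N (x y : A) :
  (x - y) * cheb_kernel N x y =
  chebT x N.+1 * chebT y N - chebT x N * chebT y N.+1.
Proof.
elim: N => [|N IHN]; first by rewrite /cheb_kernel big_ord0 /=; ring.
have -> : cheb_kernel N.+1 x y = cheb_kernel N x y + 2 * (chebT x N.+1 * chebT y N.+1).
  by rewrite /cheb_kernel big_ord_recr /=; ring.
by rewrite mulrDr IHN !chebTSS; ring.
Qed.

Lemma chebT_sqr_le1 (R : realFieldType) (x : R) k :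
  x ^+ 2 <= 1 -> chebT x k ^+ 2 <= 1.
Proof.
move=> x1; rewrite -(chebT_pell x k) lerDl mulr_ge0 ?sqr_ge0//; lra.
Qed.

Lemma cheb_kernel_le (R : realFieldType) N (x y : R) :
  x ^+ 2 <= 1 -> y ^+ 2 <= 1 -> `|cheb_kernel N x y| <= 2 * N.+1%:R.
Proof.
move=> x1 y1; rewrite (le_trans (ler_normD _ _))// normrM normr1 normr_nat.
have : `|\sum_(k < N) chebT x k.+1 * chebT y k.+1| <= N%:R.
  rewrite (le_trans (ler_norm_sum _ _ _))// -[leRHS]mulr1 mulr_natl.
  rewrite -[in leRHS](card_ord N) -sumr_const ler_sum// => k _.
  have T1 (z : R) : z ^+ 2 <= 1 -> `|chebT z k.+1| <= 1.
    by move=> z1; rewrite -(@expr_le1 _ 2)// real_normK ?num_real// chebT_sqr_le1.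
  by rewrite normrM mulr_ile1 ?T1.
by rewrite -[N.+1]addn1 natrD; lra.
Qed.

(* The squares of [chebT y] at [k] and [2 * k] cannot both be small: with [u = chebT y k ^+ 2],
   [u + (2 * u - 1) ^+ 2 >= 7 / 16]. *)
Lemma cheb_kernel_diag_ge (R : realFieldType) N (y : R) :
  7 / 64 * N.+1%:R <= cheb_kernel N y y.
Proof.
pose s n := \sum_(k < n) chebT y k ^+ 2.
have s_le : {homo s : m n / (m <= n)%N >-> m <= n}.
  apply: homo_leq => // [m n p|n]; first exact: le_trans.
  by rewrite /s big_ord_recr /= lerDl sqr_ge0.
have s_ge : s N.+1 <= cheb_kernel N y y.
  rewrite /s big_ord_recl /= expr1n /cheb_kernel lerD2l.
  rewrite -[leLHS]mul1r ler_pM ?ler1n//.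
  by rewrite sumr_ge0// => k _; rewrite sqr_ge0.
have s_even j : \sum_(k < j.+1) chebT y k.*2 ^+ 2 <= s j.*2.+1.
  elim: j => [|j IHj]; first by rewrite /s !big_ord_recr !big_ord0.
  rewrite big_ord_recr /= doubleS /s [leRHS]big_ord_recr.
  rewrite [X in _ <= X + _]big_ord_recr lerD2r /=.
  by apply: (le_trans IHj); rewrite lerDl sqr_ge0.
have s_double j : 7 / 16 * j.+1%:R <= s j.+1 + \sum_(k < j.+1) chebT y k.*2 ^+ 2.
  rewrite -big_split /= -[j.+1 in leLHS]card_ord -sum1_card natr_sum mulr_sumr.
  apply: ler_sum => k _; rewrite chebT_double mulr1.
  have := sqr_ge0 (chebT y k ^+ 2 - 3 / 8); nra.
have Nhalf : (N.+1 <= 2 * N./2.+1)%N.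
  by rewrite mul2n doubleS -[N in leqLHS]odd_double_half; case: odd.
have Ndbl : (N./2.*2.+1 <= N.+1)%N by rewrite ltnS -[leqRHS]odd_double_half leq_addl.
have Nle : (N./2.+1 <= N.+1)%N by rewrite (leq_trans _ Ndbl)// -addnn ltnS leq_addr.
(* Both sums in [s_double] are at most [s N.+1], so [7 / 16 * (N./2 + 1) <= 2 * s N.+1]; together
   with [N + 1 <= 2 * (N./2 + 1)] this produces [7 / 64]. *)
have := s_double N./2; have := s_even N./2; have := s_le _ _ Ndbl; have := s_le _ _ Nle.
move: Nhalf; rewrite -(ler_nat R) natrM; lra.
Qed.

(* By the Darboux formula and the recurrence for [chebT], [(x - y) * cheb_kernel N x y]
   is a sum of three terms, bounded by [|x - y|], [sqrt (1 - x ^+ 2)] and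
   [sqrt (1 - y ^+ 2)]. *)
Lemma cheb_kernel_dist_sqr (R : realFieldType) N (x y : R) :
  x ^+ 2 <= 1 -> y ^+ 2 <= 1 ->
  (x - y) ^+ 2 * cheb_kernel N x y ^+ 2 <=
    3 * (4 * `|x - y| + 2 * (1 - y ^+ 2)).
Proof.
move=> x1 y1; rewrite -exprMn cheb_kernel_darboux !chebTS.
have := chebT_pell x N; have := chebT_pell y N.
have := chebT_sqr_le1 N x1; have := chebT_sqr_le1 N y1.
set s := chebT x N; set t := chebT y N; set v := chebV x N; set w := chebV y N.
move=> t1 s1 pt ps.
have -> : (x * s - (1 - x ^+ 2) * v) * t - s * (y * t - (1 - y ^+ 2) * w) =
  (x - y) * (s * t) + - ((1 - x ^+ 2) * v * t) + (1 - y ^+ 2) * w * s by ring.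
have sqr3 (a b c : R) : (a + b + c) ^+ 2 <= 3 * (a ^+ 2 + b ^+ 2 + c ^+ 2).
  have := sqr_ge0 (a - b); have := sqr_ge0 (a - c); have := sqr_ge0 (b - c); nra.
have mul_le (a b : R) : 0 <= a -> 0 <= b -> b <= 1 -> a * b <= a.
  by move=> a0 b0 b1; rewrite -[leRHS]mulr1 ler_wpM2l.
(* The identity [chebT_pell] bounds [(1 - x ^+ 2) * v ^+ 2] by 1, which leaves one factor
   [1 - x ^+ 2]; [wy] is the same for [y]. *)
have vx : ((1 - x ^+ 2) * v * t) ^+ 2 <= 1 - x ^+ 2.
  have -> : ((1 - x ^+ 2) * v * t) ^+ 2 =
            (1 - x ^+ 2) * (((1 - x ^+ 2) * v ^+ 2) * t ^+ 2) by ring.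
  have v0 : 0 <= (1 - x ^+ 2) * v ^+ 2 by rewrite mulr_ge0 ?sqr_ge0//; lra.
  apply: mul_le => //; first by lra.
    by rewrite mulr_ge0 ?sqr_ge0.
  by rewrite mulr_ile1 ?sqr_ge0//; have := sqr_ge0 s; lra.
have wy : ((1 - y ^+ 2) * w * s) ^+ 2 <= 1 - y ^+ 2.
  have -> : ((1 - y ^+ 2) * w * s) ^+ 2 =
            (1 - y ^+ 2) * (((1 - y ^+ 2) * w ^+ 2) * s ^+ 2) by ring.
  have w0 : 0 <= (1 - y ^+ 2) * w ^+ 2 by rewrite mulr_ge0 ?sqr_ge0//; lra.
  apply: mul_le => //; first by lra.
    by rewrite mulr_ge0 ?sqr_ge0.
  by rewrite mulr_ile1 ?sqr_ge0//; have := sqr_ge0 t; lra.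
have st : ((x - y) * (s * t)) ^+ 2 <= (x - y) ^+ 2.
  by rewrite exprMn; apply: mul_le; rewrite ?sqr_ge0// exprMn mulr_ile1 ?sqr_ge0.
rewrite (le_trans (sqr3 _ _ _))// sqrrN ler_pM2l//.
have xn1 (z : R) : z ^+ 2 <= 1 -> `|z| <= 1.
  by move=> z1; rewrite -(@expr_le1 _ 2)// real_normK ?num_real.
have xy2 : `|x + y| <= 2.
  rewrite (le_trans (ler_normD _ _))//; have := xn1 _ x1; have := xn1 _ y1; lra.
(* This trades [1 - x ^+ 2] for [1 - y ^+ 2 + 2 * |x - y|], so that the final bound involves [x]
   only through [|x - y|]. *)
have yx : y ^+ 2 - x ^+ 2 <= 2 * `|x - y|.
  rewrite subr_sqr (le_trans (ler_norm _))// normrM (distrC y) mulrC addrC.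
  by rewrite ler_wpM2r.
have xy : (x - y) ^+ 2 <= 2 * `|x - y|.
  rewrite -real_normK ?num_real// expr2 ler_wpM2r//.
  rewrite (le_trans (ler_normB _ _))//; have := xn1 _ x1; have := xn1 _ y1; lra.
lra.
Qed.

(** Write [q] for the kernel, [M = N + 1] and [u = |x - y|]. The bound [|q| <= 2 * M] handles the
    term with [(r / M) ^+ 2], and also the term with [u ^+ 2] when [u <= r / M]; each costs
    [16 * (r * M) ^+ 2]. When [u >= r / M], [cheb_kernel_dist_sqr] gives [u ^+ 2 * q ^+ 2 <= 12 * u
    + 6 * a * r ^+ 2], where [r ^+ 2 <= u * (r * M)] and [1 <= r * M / c]; dividing by [u] bounds
    [u * q ^+ 2] by a multiple of [r * M]. *)
Lemma cheb_kernel_decay (R : realFieldType) N (x y a r c : R) :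
  x ^+ 2 <= 1 -> y ^+ 2 <= 1 -> 0 <= a -> 1 - y ^+ 2 <= a * r ^+ 2 ->
  0 < r -> 0 < c -> c <= r * N.+1%:R ->
  cheb_kernel N x y ^+ 4 * ((r / N.+1%:R) ^+ 2 + (x - y) ^+ 2) <=
    (32 + 9 * (4 / c + 2 * a) ^+ 2) * (r * N.+1%:R) ^+ 2.
Proof.
move=> x1 y1 a0 ya r0 c0 cr.
have := cheb_kernel_le N x1 y1; have := cheb_kernel_dist_sqr N x1 y1.
set q := cheb_kernel N x y; set u := `|x - y|; set M := N.+1%:R in cr * => qu qM.
have M0 : 0 < M :> R by rewrite ltr0n.
have u2 : (x - y) ^+ 2 = u ^+ 2 by rewrite real_normK ?num_real.
have u0 : 0 <= u by exact: normr_ge0.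
rewrite u2 in qu *; clearbody M u.
have q2 : q ^+ 2 <= 4 * M ^+ 2.
  have -> : 4 * M ^+ 2 = (2 * M) ^+ 2 by ring.
  by rewrite -real_normK ?num_real// ler_pXn2r ?nnegrE// ?mulr_ge0// ltW.
have q4 : q ^+ 4 <= 16 * M ^+ 4.
  have -> : 16 * M ^+ 4 = (4 * M ^+ 2) ^+ 2 by ring.
  by rewrite (exprM q 2 2) ler_pXn2r ?nnegrE ?sqr_ge0// mulr_ge0// sqr_ge0.
have near (z : R) : 0 <= z -> z <= r / M -> q ^+ 4 * z ^+ 2 <= 16 * (r * M) ^+ 2.
  move=> z0 zr; have -> : 16 * (r * M) ^+ 2 = 16 * M ^+ 4 * (r / M) ^+ 2.
    by field; rewrite gt_eqF.
  rewrite ler_pM ?sqr_ge0//; first by rewrite (exprM q 2 2) sqr_ge0.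
  by rewrite ler_pXn2r ?nnegrE// (le_trans z0).
rewrite mulrDr !mulrDl.
have h0 : 0 <= r / M by rewrite divr_ge0// ltW.
have := near _ h0 (lexx _).
have K0 : 0 <= 9 * (4 / c + 2 * a) ^+ 2 * (r * M) ^+ 2.
  by rewrite mulr_ge0 ?sqr_ge0// mulr_ge0 ?sqr_ge0.
have [ur|/ltW ur] := leP u (r / M); first by have := near _ u0 ur; lra.
suff : q ^+ 4 * u ^+ 2 <= 9 * (4 / c + 2 * a) ^+ 2 * (r * M) ^+ 2.
  by have := sqr_ge0 (r * M); lra.
have -> : q ^+ 4 * u ^+ 2 = (u * q ^+ 2) ^+ 2 by ring.
have -> : 9 * (4 / c + 2 * a) ^+ 2 * (r * M) ^+ 2 =
    (3 * ((4 / c + 2 * a) * (r * M))) ^+ 2.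
  by ring.
have up : 0 < u by rewrite (lt_le_trans _ ur)// divr_gt0.
have rM0 : 0 <= r * M by rewrite mulr_ge0 ?ltW.
have ca0 : 0 <= 4 / c + 2 * a 
  by rewrite addr_ge0 ?(mulr_ge0 _ a0)// divr_ge0// ltW.
have uq0 : 0 <= u * q ^+ 2 by rewrite mulr_ge0 ?sqr_ge0.
rewrite ler_pXn2r ?nnegrE//; last by rewrite mulr_ge0// mulr_ge0.
rewrite -(ler_pM2l up).
have ruM : r ^+ 2 <= u * (r * M).
  by rewrite expr2 mulrCA ler_pM2l// -ler_pdivrMr.
have cu : 4 * u <= u * (4 / c * (r * M)).
  rewrite mulrC ler_pM2l// mulrAC -mulrA ler_peMr// ler_pdivlMr// mul1r.
  exact: cr.
have aru : a * r ^+ 2 <= a * (u * (r * M)) by rewrite ler_wpM2l.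
have -> : u * (u * q ^+ 2) = u ^+ 2 * q ^+ 2 by ring.
rewrite (le_trans qu)//.
have -> : u * (3 * ((4 / c + 2 * a) * (r * M))) =
  3 * (u * (4 / c * (r * M)) + 2 * (a * (u * (r * M)))) by ring.
by rewrite ler_pM2l//; lra.
Qed.

(** With [M = N + 1] and [h = r / M], one has [(r * M) ^+ 2 = h ^+ 2 * M ^+ 4], and [M] is at most
    [64 / 7] times the diagonal value. The fourth power is needed because the available bound on the
    square of the kernel decays only like [1 / |x - y|], which is not integrable over the line. *)
Lemma cheb_kernel_bump (R : realType) N (x y a r c : R) :
  x ^+ 2 <= 1 -> y ^+ 2 <= 1 -> 0 <= a -> 1 - y ^+ 2 <= a * r ^+ 2 ->
  0 < r -> 0 < c -> c <= r * N.+1%:R ->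
  (cheb_kernel N x y / cheb_kernel N y y) ^+ 4 <=
    (64 / 7) ^+ 4 * (32 + 9 * (4 / c + 2 * a) ^+ 2) *
      (oneDsqr ((x - y) / (r / N.+1%:R)))^-1.
Proof.
move=> x1 y1 a0 ya r0 c0 cr.
have := cheb_kernel_decay x1 y1 a0 ya r0 c0 cr.
have := cheb_kernel_diag_ge N y.
set K := 32 + _; set M := N.+1%:R; set q := cheb_kernel N x y.
set q0 := cheb_kernel N y y => q0M qK.
have M0 : 0 < M by rewrite /M ltr0n.
clearbody q q0 M.
have q00 : 0 < q0 by rewrite (lt_le_trans _ q0M)// mulr_gt0.
have h0 : 0 < r / M by rewrite divr_gt0.
have s0 : 0 < oneDsqr ((x - y) / (r / M)) by rewrite (lt_le_trans ltr01)// oneDsqr_ge1.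
rewrite ler_pdivlMr// expr_div_n mulrAC ler_pdivrMr ?exprn_gt0//.
rewrite -(ler_pM2l (exprn_gt0 2 h0)).
have -> : (r / M) ^+ 2 * (q ^+ 4 * oneDsqr ((x - y) / (r / M))) =
    q ^+ 4 * ((r / M) ^+ 2 + (x - y) ^+ 2).
  by rewrite /oneDsqr; field; rewrite !gt_eqF.
rewrite (le_trans qK)//.
have -> : (r / M) ^+ 2 * ((64 / 7) ^+ 4 * K * q0 ^+ 4) =
    K * ((r / M) ^+ 2 * (64 / 7 * q0) ^+ 4) by ring.
have K0 : 0 <= K by rewrite addr_ge0// mulr_ge0// sqr_ge0.
rewrite ler_wpM2l//.
have -> : (r * M) ^+ 2 = (r / M) ^+ 2 * M ^+ 4 by field; rewrite gt_eqF.
rewrite ler_wpM2l ?sqr_ge0// ler_pXn2r ?nnegrE ?mulr_ge0// ?(ltW M0) ?(ltW q00)//.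
by move: q0M; lra.
Qed.

(** * Integrals over R^d *)

Lemma continuous_oneDsqrV_affine (R : realType) (e b : R) :
  continuous (fun x : R => (oneDsqr (e + b * x))^-1).
Proof.
move=> x; apply: (@continuous_comp _ _ _ (fun x => e + b * x)
  (fun z => (oneDsqr z)^-1)).
  apply: continuousD; first exact: cst_continuous.
  by apply: continuousM; [exact: cst_continuous|exact: cvg_id].
exact: continuous_oneDsqrV.
Qed.

(** An antiderivative is [b^-1 * atan (e + b * x)], and the arctangent varies by less than [pi]. *)
Lemma integral_oneDsqrV_affine_itv (R : realType) (e b l r : R) : 0 < b -> l < r ->
  (\int[lebesgue_measure]_(x in `[l, r]) ((oneDsqr (e + b * x))^-1)%:E <=
    (pi / b)%:E)%E.
Proof.
move=> b0 lr.
pose F (x : R) : R := b^-1 * atan (e + b * x).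
have dF (x : R) : is_derive x 1 F (oneDsqr (e + b * x))^-1.
  have dL : is_derive x 1 (fun y : R => e + b * y) b.
    by apply: is_derive_eq; rewrite add0r mul1r /GRing.scale/= mulr1.
  have dA : is_derive x 1 (atan \o (fun y : R => e + b * y)) _ :=
    @is_derive1_comp _ _ (fun y : R => e + b * y) _ _ _ (is_derive1_atan _) dL.
  rewrite (_ : _^-1 = b^-1 *: ((1 + (e + b * x) ^+ 2)^-1 * b)).
    exact: is_deriveZ.
  by rewrite /GRing.scale/= mulrCA mulVf ?gt_eqF// mulr1.
have cF : continuous F.
  move=> x; apply/differentiable_continuous/derivable1_diffP.
  by have [] := dF x.
rewrite (@continuous_FTC2 _ _ F)//; last first.
- by move=> x _; rewrite derive1E; have [] := dF x.
- split; first by move=> x _; have [] := dF x.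
    exact/cvg_at_right_filter/cF.
  exact/cvg_at_left_filter/cF.
- by apply: continuous_subspaceT; exact: continuous_oneDsqrV_affine.
rewrite -EFinB lee_fin /F -mulrBr mulrC ler_pM2r ?invr_gt0//.
have := atan_ltpi2 (e + b * r); have := atan_gtNpi2 (e + b * l).
lra.
Qed.

Lemma integral_oneDsqrV_affine (R : realType) (e b : R) : 0 < b ->
  (\int[lebesgue_measure]_x ((oneDsqr (e + b * x))^-1)%:E <= (pi / b)%:E)%E.
Proof.
move=> b0.
(* The successor keeps every interval nondegenerate, as the bound on intervals requires. *)
pose F (n : nat) : set R := [set` `[- n.+1%:R, n.+1%:R]].
have FT : \bigcup_n F n = setT.
  apply/seteqP; split => // x _; exists (Num.bound `|x|) => //.
  rewrite /F /= in_itv/= -ler_norml (le_trans (ltW (archi_boundP _)))//.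
  by rewrite ler_nat.
have ndF : nondecreasing_seq F.
  move=> m n mn; apply/subsetPset; apply: subset_itv;
  by rewrite bnd_simp ?lerN2 ler_nat.
have mg A : measurable_fun A (fun x : R => ((oneDsqr (e + b * x))^-1)%:E).
  apply/measurable_EFinP; apply: measurable_funTS.
 apply: continuous_measurable_fun; exact: continuous_oneDsqrV_affine.
have g0 (x : R) : (0 <= ((oneDsqr (e + b * x))^-1)%:E)%E.
  by rewrite lee_fin invr_ge0; exact: (le_trans ler01 (oneDsqr_ge1 _)).
have cvgF : (\int[lebesgue_measure]_(x in F i) ((oneDsqr (e + b * x))^-1)%:E
    @[i --> \oo] -->
    \int[lebesgue_measure]_(x in \bigcup_i F i) ((oneDsqr (e + b * x))^-1)%:E)%E.
  apply: ge0_nondecreasing_set_cvg_integral => //.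
  - by move=> n; exact: measurable_itv.
  - by move=> n; exact: mg.
rewrite -FT -(cvg_lim _ cvgF)//.
apply: lime_le; first by apply/cvg_ex; eexists; exact: cvgF.
apply: nearW => n; apply: integral_oneDsqrV_affine_itv => //.
by rewrite gtrN.
Qed.

(** Tonelli's theorem, transported along the pushforward that defines [lebesgue_Rn]. *)
Lemma integral_Rn_cons (R : realType) (d : nat) (f : Rn R d.+1 -> \bar R) :
  measurable_fun setT f -> (forall x, 0 <= f x)%E ->
  (\int[lebesgue_Rn R d.+1]_x f x =
   \int[lebesgue_measure]_x \int[lebesgue_Rn R d]_t f (Rn_cons (x, t)))%E.
Proof.
move=> mf f0.
have mc := @measurable_Rn_cons R d.
rewrite [LHS](ge0_integral_pushforward mc)//.
rewrite preimage_setT fubini_tonelli1//.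
- exact: measurableT_comp.
- by move=> x; exact: f0.
Qed.

Lemma measurable_prod_tnth (R : realType) (d : nat) (k : 'I_d -> R -> R) :
  (forall i, measurable_fun setT (k i)) ->
  measurable_fun setT (fun t : Rn R d => \prod_(i < d) k i (tnth t i)).
Proof.
move=> mk; apply: measurable_prod => i _.
by apply: measurableT_comp; [exact: mk|exact: measurable_tnth].
Qed.

Lemma integral_Rn_cons_le (R : realType) (d : nat) (f : Rn R d.+1 -> R)
    (h : R -> R) (g : R -> Rn R d -> R) (a c : R) :
  measurable_fun setT f -> measurable_fun setT h ->
  (forall x, measurable_fun setT (g x)) ->
  (forall x, 0 <= h x) -> (forall x t, 0 <= g x t) ->
  (forall x t, f (Rn_cons (x, t)) = h x * g x t) ->
  (\int[lebesgue_measure]_x (h x)%:E <= a%:E)%E ->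
  0 <= c -> (forall x, \int[lebesgue_Rn R d]_t (g x t)%:E <= c%:E)%E ->
  (\int[lebesgue_Rn R d.+1]_t (f t)%:E <= (a * c)%:E)%E.
Proof.
move=> mf mh mg h0 g0 fE ha c0 gc.
have f0 t : (0 <= (f t)%:E)%E.
  by rewrite -(Rn_unconsK t); case: (Rn_uncons t) => x u; rewrite fE lee_fin mulr_ge0.
have mEf : measurable_fun setT (fun t => (f t)%:E) by exact/measurable_EFinP.
have mEh : measurable_fun setT (fun x => (h x)%:E) by exact/measurable_EFinP.
rewrite integral_Rn_cons//.
apply: (@le_trans _ _ (\int[lebesgue_measure]_x (c%:E * (h x)%:E))%E).
  apply: ge0_le_integral => //.
  - by move=> x _; exact: integral_ge0.
  - apply: (@measurable_fun_fubini_tonelli_F _ _ _ _ _ _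
      (fun z => (f (Rn_cons z))%:E)) => [|z]; last exact: f0.
    exact: (measurableT_comp mEf (@measurable_Rn_cons R d)).
  - exact: measurable_funeM.
  move=> x _.
  under eq_integral => t _ do rewrite fE EFinM.
  rewrite ge0_integralZl//; last 3 first.
  - exact/measurable_EFinP.
  - by move=> t _; rewrite lee_fin.
  - by rewrite lee_fin.
  by rewrite muleC lee_wpmul2r ?lee_fin.
rewrite ge0_integralZl//; last by move=> x _; rewrite lee_fin.
by rewrite mulrC EFinM lee_wpmul2l ?lee_fin.
Qed.

Lemma integral_Rn_prod_le (R : realType) (d : nat) (k : 'I_d -> R -> R) (c : R) :
  (forall i, measurable_fun setT (k i)) -> (forall i x, 0 <= k i x) ->
  (forall i, \int[lebesgue_measure]_x (k i x)%:E <= c%:E)%E ->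
  (\int[lebesgue_Rn R d]_t (\prod_(i < d) k i (tnth t i))%:E <= (c ^+ d)%:E)%E.
Proof.
elim: d k => [|d IHd] k mk k0 kc.
  rewrite integral_dirac//=; last first.
    by apply/measurable_EFinP; exact: (measurable_prod_tnth mk).
  by rewrite big_ord0 diracE mem_set// mul1e expr0.
have c0 : 0 <= c.
  rewrite -lee_fin; apply: le_trans (kc ord0).
  by apply: integral_ge0 => x _; rewrite lee_fin.
rewrite exprS; apply: (@integral_Rn_cons_le _ _ _ (k ord0)
  (fun _ t => \prod_(i < d) k (lift ord0 i) (tnth t i))) => //.
- exact: (measurable_prod_tnth mk).
- by move=> _; exact: (measurable_prod_tnth (fun i => mk (lift ord0 i))).
- by move=> _ t; rewrite prodr_ge0.
- by move=> x t; rewrite big_ord_recl; under eq_bigr do rewrite tnthS.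
- by rewrite exprn_ge0.
- by move=> _; apply: (IHd (fun i => k (lift ord0 i))).
Qed.

(** Used with [e = - (y / h)], [a = s / h] and [b] equal to the shear slope times [a]: factor [i] is
    then the bump [1 / (1 + z ^+ 2)] at [z = (L - y) / h], for the [i]-th linear form [L]. *)
Definition affine_bumps (R : realType) (d : nat) (e a b : R) (t : Rn R d.+1) : R :=
  \prod_(i < d.+1) (oneDsqr (e + a * tnth t ord0 +
    (if i == ord0 then 0 else b) * tnth t i))^-1.

Lemma affine_bumps_ge0 (R : realType) (d : nat) (e a b : R) (t : Rn R d.+1) :
  0 <= affine_bumps e a b t.
Proof.
by rewrite prodr_ge0// => i _; rewrite invr_ge0 (le_trans ler01)// oneDsqr_ge1.
Qed.

Lemma measurable_affine_bumps (R : realType) (d : nat) (e a b : R) :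
  measurable_fun setT (@affine_bumps R d e a b).
Proof.
have mV1 : measurable_fun setT (fun x : R => (oneDsqr x)^-1).
  by apply: continuous_measurable_fun; exact: continuous_oneDsqrV.
apply: measurable_prod => i _.
apply: (measurableT_comp mV1); apply: measurable_funD.
  apply: measurable_funD => //; apply: measurable_funM => //.
  exact: measurable_tnth.
by apply: measurable_funM => //; exact: measurable_tnth.
Qed.

(** The forms are triangular. Once the coordinate 0 is fixed, every other factor depends on a single
    coordinate, and its integral is at most [pi / b] whatever the shift [e + a * x]. Integrating in
    this order plays the part of the linear change of variables and its Jacobian. *)
Lemma integral_affine_bumps_le (R : realType) (d : nat) (e a b : R) :
  0 < a -> 0 < b ->
  (\int[lebesgue_Rn R d.+1]_t (affine_bumps e a b t)%:E <=
   (pi / a * (pi / b) ^+ d)%:E)%E.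
Proof.
move=> a0 b0.
have mV (u v : R) : measurable_fun setT (fun x : R => (oneDsqr (u + v * x))^-1).
  by apply: continuous_measurable_fun; exact: continuous_oneDsqrV_affine.
have V0 (x : R) : 0 <= (oneDsqr x)^-1.
  by rewrite invr_ge0 (le_trans ler01)// oneDsqr_ge1.
have pb0 : 0 <= pi / b by rewrite divr_ge0 ?pi_ge0 ?ltW.
apply: (@integral_Rn_cons_le _ _ _ (fun x => (oneDsqr (e + a * x))^-1)
  (fun x t => \prod_(i < d) (oneDsqr ((e + a * x) + b * tnth t i))^-1)) => //.
- exact: measurable_affine_bumps.
- by move=> x; exact: (measurable_prod_tnth (fun=> mV _ _)).
- by move=> x t; rewrite prodr_ge0.
- move=> x t; rewrite /affine_bumps big_ord_recl eqxx mul0r addr0; congr (_ * _).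
  by apply: eq_bigr => i _; rewrite tnthS.
- exact: integral_oneDsqrV_affine.
- by rewrite exprn_ge0.
- move=> x; apply: (@integral_Rn_prod_le _ _
    (fun _ y => (oneDsqr ((e + a * x) + b * y))^-1)) => // _.
  exact: integral_oneDsqrV_affine.
Qed.

(** * Polynomials on subsets of the unit cube *)

(** A set of finite measure on which every monomial is bounded by 1; containing the ball, it makes
    all polynomials integrable there. *)
Definition unit_cube (R : realType) (d : nat) : set (Rn R d) :=
  [set x | forall i, `|tnth x i| <= 1].
Arguments unit_cube {R d}.

Lemma measurable_peval (R : realType) (d : nat) (p : mpoly d R) :
  measurable_fun setT (peval p).
Proof.
elim/mpolyind: p => [|c m p _ _ IHp].
  rewrite (_ : peval 0 = cst 0)//.
  by apply/funext => x; rewrite /peval meval0.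
rewrite (_ : peval _ =
    fun x : Rn R d => c * \prod_(i < d) tnth x i ^+ m i + peval p x); last first.
  by apply/funext => x; rewrite /peval mevalD mevalZ mevalX.
apply: measurable_funD => //; apply: measurable_funM => //.
apply: measurable_prod => i _; apply: measurable_funX; exact: measurable_tnth.
Qed.

Lemma peval_bounded (R : realType) (d : nat) (p : mpoly d R) :
  exists B : R, forall x, unit_cube x -> `|peval p x| <= B.
Proof.
elim/mpolyind: p => [|c m p _ _ [B IHp]].
  by exists 0 => x _; rewrite /peval meval0 normr0.
exists (`|c| + B) => x x1; rewrite /peval mevalD mevalZ mevalX.
rewrite (le_trans (ler_normD _ _))// lerD ?IHp// normrM -[leRHS]mulr1.
rewrite ler_wpM2l// normr_prod prodr_ile1// => i _.
by rewrite normrX exprn_ge0//= exprn_ile1 ?x1.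
Qed.

Lemma measurable_unit_cube (R : realType) (d : nat) :
  measurable (@unit_cube R d).
Proof.
rewrite [X in measurable X](_ : _ = \bigcap_(i in [set: 'I_d])
    ((fun x : Rn R d => tnth x i) @^-1` `[-1, 1])); last first.
  apply/seteqP; split=> x /= x1 i.
    by move=> _ /=; rewrite in_itv/= -ler_norml.
  by have := x1 i I; rewrite /= in_itv/= -ler_norml.
apply: fin_bigcap_measurable => // i _.
by rewrite -[X in measurable X]setTI; exact: measurable_tnth.
Qed.

Lemma lebesgue_unit_cube (R : realType) (d : nat) :
  (lebesgue_Rn R d unit_cube < +oo)%E.
Proof.
have -> : unit_cube = [set x : Rn R d | forall i, `[-1, 1]%classic (tnth x i)].
  by apply/seteqP; split => x /= x1 i; have := x1 i; rewrite in_itv/= ler_norml.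
rewrite (lebesgue_Rn_box (A := fun=> `[-1, 1]%classic))//.
rewrite (eq_bigr (fun=> 2%:E)); last first.
  by move=> i _; rewrite lebesgue_measure_itv/= lte_fin ifT -?EFinB//; congr EFin; ring.
by rewrite prodEFin ltry.
Qed.

Section inner_product.
Variables (R : realType) (d : nat) (D : set (Rn R d)).
Hypotheses (mD : measurable D) (D1 : D `<=` unit_cube).

Lemma integrable_peval (p : mpoly d R) :
  (lebesgue_Rn R d).-integrable D (EFin \o peval p).
Proof.
apply: measurable_bounded_integrable => //.
- rewrite (le_lt_trans _ (lebesgue_unit_cube R d))// le_measure ?inE//.
  exact: measurable_unit_cube.
- apply: measurable_funTS; exact: measurable_peval.
have [B pB] := peval_bounded p.
exists B; split; first exact: num_real.
by move=> C BC x /= /D1 /pB; move/le_trans; apply; exact: ltW.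
Qed.

Definition pint (p : mpoly d R) : R := \int[lebesgue_Rn R d]_(y in D) peval p y.

Lemma pintD : {morph pint : p q / p + q >-> p + q}.
Proof.
move=> p q; rewrite /pint -RintegralD//; try exact: integrable_peval.
by apply: eq_Rintegral => x _; rewrite /peval mevalD.
Qed.

Lemma pintZ c p : pint (c *: p) = c * pint p.
Proof.
rewrite /pint -RintegralZl//; last exact: integrable_peval.
by apply: eq_Rintegral => x _; rewrite /peval mevalZ.
Qed.

Lemma pint0 : pint 0 = 0.
Proof. by rewrite -(scale0r 0) pintZ mul0r. Qed.

Lemma innerE p q : inner D p q = pint (p * q).
Proof. by apply: eq_Rintegral => x _; rewrite /peval mevalM. Qed.

(** Parseval's identity. *)
Lemma inner_orthonormal_sum (N : nat) (phi : 'I_N -> mpoly d R) (c : 'rV[R]_N) :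
  (forall j k, inner D (phi j) (phi k) = (j == k)%:R) ->
  inner D (\sum_k c 0 k *: phi k) (\sum_k c 0 k *: phi k) = \sum_k c 0 k ^+ 2.
Proof.
move=> orth; rewrite innerE mulr_suml (big_morph _ pintD pint0).
apply: eq_bigr => j _; rewrite mulr_sumr (big_morph _ pintD pint0).
rewrite (bigD1 j)//= big1 ?addr0 => [|k kj].
  by rewrite -scalerAl -scalerAr !pintZ -innerE orth eqxx mulr1 expr2.
by rewrite -scalerAl -scalerAr !pintZ -innerE orth eq_sym (negPf kj) !mulr0.
Qed.

(** Cauchy-Schwarz for the coefficients [c] of [f] and the values at [x] of the basis: their scalar
    product is [f x = 1]. *)
Lemma christoffel_le (n : nat) (x : Rn R d) (f : mpoly d R) :
  polys_le n f -> peval f x = 1 -> christoffel n D x <= inner D f f.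
Proof.
move=> fn fx; rewrite /christoffel.
(* [get] of an empty set is [0]. *)
case: xgetP => [l _ [N [phi [[_ span orth] ->]]]|_]; last first.
  rewrite [leLHS](_ : _ = 0)//; apply: Rintegral_ge0 => y _; exact: sqr_ge0.
have [c [fE _]] := span _ fn; rewrite {1 2}fE (inner_orthonormal_sum _ orth).
set S := (X in X^-1 <= _).
(* The inverse of 0 is 0, so this case only needs the right-hand side to be nonnegative. *)
have [->|S0] := eqVneq S 0; first by rewrite invr0 sumr_ge0// => k _; rewrite sqr_ge0.
have Sgt0 : 0 < S by rewrite lt_neqAle eq_sym S0 sumr_ge0// => k _; rewrite sqr_ge0.
have cphi : \sum_k c 0 k * peval (phi k) x = 1.
  rewrite -fx fE /peval [RHS](raddf_sum (meval (tnth x))).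
  by apply: eq_bigr => k _; rewrite /= mevalZ.
have sqrE (t : R) : \sum_k (t * c 0 k - peval (phi k) x) ^+ 2 =
    t ^+ 2 * (\sum_k c 0 k ^+ 2) - 2 * t * (\sum_k c 0 k * peval (phi k) x) +
    \sum_k peval (phi k) x ^+ 2.
  by rewrite !mulr_sumr -sumrB -big_split/=; apply: eq_bigr => k _; ring.
(* Taking [t = S] in [sqrE] gives [0 <= S ^+ 2 * C - S], where [C] is the sum of the squares of the
   coefficients; hence [1 <= S * C]. *)
have : 0 <= \sum_k (S * c 0 k - peval (phi k) x) ^+ 2.
  by rewrite sumr_ge0// => k _; rewrite sqr_ge0.
rewrite sqrE -/S cphi mulr1 => SC.
rewrite -[leLHS]mul1r ler_pdivrMr// -(ler_pM2l Sgt0); nra.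
Qed.

End inner_product.

(** * Degree bounds for polynomials and for the kernel of a linear form *)

Lemma polys_le_leq (R : realType) d m n (p : mpoly d R) :
  (m <= n)%N -> polys_le m p -> polys_le n p.
Proof. by move=> mn; rewrite /polys_le/= => /leq_trans; apply. Qed.

Lemma polys_leC (R : realType) d n (c : R) : polys_le n (mpolyC d c).
Proof. by rewrite /polys_le/= msizeC (leq_trans (leq_b1 _)). Qed.

Lemma polys_leX (R : realType) d (i : 'I_d) : polys_le 1 (mpolyX R (mnm1 i)).
Proof. by rewrite /polys_le/= msizeX mdeg1. Qed.

Lemma polys_leD (R : realType) d n (p q : mpoly d R) :
  polys_le n p -> polys_le n q -> polys_le n (p + q).
Proof.
rewrite /polys_le/= => pn qn.
by rewrite (leq_trans (msizeD_le _ _))// geq_max pn.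
Qed.

Lemma polys_leZ (R : realType) d n (c : R) (p : mpoly d R) :
  polys_le n p -> polys_le n (c *: p).
Proof. by rewrite /polys_le/=; exact/leq_trans/msizeZ_le. Qed.

Lemma polys_leM (R : realType) d m n (p q : mpoly d R) :
  polys_le m p -> polys_le n q -> polys_le (m + n) (p * q).
Proof.
rewrite /polys_le/= => pm qn.
have [->|p0] := eqVneq p 0; first by rewrite mul0r msize0.
have [->|q0] := eqVneq q 0; first by rewrite mulr0 msize0.
rewrite msizeM// -ltnS prednK; last first.
  by rewrite addn_gt0 lt0n msize_poly_eq0 p0.
by rewrite (leq_trans (leq_add pm qn))// addSn addnS.
Qed.

Lemma polys_le_prod (R : realType) d n m (F : 'I_m -> mpoly d R) :
  (forall i, polys_le n (F i)) -> polys_le (m * n) (\prod_(i < m) F i).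
Proof.
elim: m F => [|m IHm] F Fn; first by rewrite big_ord0 -mpolyC1; exact: polys_leC.
by rewrite big_ord_recl mulSn; apply: polys_leM => //; exact: IHm.
Qed.

Lemma polys_le_chebT (R : realType) d (L : mpoly d R) k :
  polys_le 1 L -> polys_le k (chebT L k).
Proof.
(* The three-term recurrence involves only [chebT], but needs two consecutive indices in the
   induction. *)
move=> L1; suff [] : polys_le k (chebT L k) /\ polys_le k.+1 (chebT L k.+1) by [].
elim: k => [|k [IHk IHk1]].
  rewrite chebTS /= mulr1 mulr0 subr0; split => //.
  by rewrite -mpolyC1; exact: polys_leC.
split => //; rewrite chebTSS; apply: polys_leD; last first.
  rewrite -scaleN1r; apply: polys_leZ; exact: (polys_le_leq (leqW (leqnSn k)) IHk).
rewrite -mulrA -[2]/(2%:R) mulr_natl -scaler_nat; apply: polys_leZ.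
exact: (polys_leM L1 IHk1).
Qed.

Lemma polys_le_cheb_kernel (R : realType) d N (L : mpoly d R) (c : R) :
  polys_le 1 L -> polys_le N (cheb_kernel N L (mpolyC d c)).
Proof.
move=> L1; apply: polys_leD; first by rewrite -mpolyC1; exact: polys_leC.
rewrite -[2]/(2%:R) mulr_natl -scaler_nat; apply: polys_leZ.
elim/big_ind : _ => [|p q|k _]; first by rewrite -(mpolyC0 d R); exact: polys_leC.
  exact: polys_leD.
rewrite (rmorph_chebyshev (@mpolyC d R)) /= mulrC mul_mpolyC; apply: polys_leZ.
exact: (polys_le_leq (ltn_ord k) (polys_le_chebT k.+1 L1)).
Qed.

(** * Boundedness and measurability of the ball *)

Lemma lball_unit_cube (R : realType) d (alpha : R) :
  0 < alpha -> lball d alpha `<=` unit_cube.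
Proof.
move=> a0 x xball i.
have xi : `|tnth x i| `^ alpha <= 1.
  rewrite (le_trans _ xball)// (bigD1 i)//= lerDl sumr_ge0//.
rewrite leNgt; apply/negP => x1.
have := gt0_ltr_powR a0 _ _ x1; rewrite !nnegrE normr_ge0 ler01 powR1 ltNge xi.
by move=> /(_ isT isT).
Qed.

Lemma measurable_lball (R : realType) d (alpha : R) :
  measurable (@lball R d alpha).
Proof.
have mf : measurable_fun setT (fun x : Rn R d => \sum_(i < d) `|tnth x i| `^ alpha).
  apply: measurable_sum => i.
  apply: (measurableT_comp (measurable_powR alpha)).
  apply: (measurableT_comp (@normr_measurable R _)).
  exact: measurable_tnth.
rewrite (_ : lball d alpha = setT `&` (fun x : Rn R d =>
    \sum_(i < d) `|tnth x i| `^ alpha) @^-1` `]-oo, 1]).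
  exact: mf.
by apply/seteqP; split => [x xb|x [_]] /=; rewrite in_itv.
Qed.

(** * The ball and the test polynomial *)

(** The exponents [1 - alpha^-1] and [alpha^-1] add up to 1, so the left-hand side is a weighted
    geometric mean of [delta] and [y ^ alpha], at most the larger of the two. *)
Lemma powR_mul_le_add (R : realType) (alpha delta y : R) :
  1 <= alpha -> 0 < delta -> 0 <= y ->
  delta `^ (1 - alpha^-1) * y <= delta + y `^ alpha.
Proof.
move=> a1 d0 y0.
have a0 : 0 < alpha by exact: lt_le_trans a1.
have yE : y = (y `^ alpha) `^ alpha^-1 by rewrite -powRrM divff ?gt_eqF// powRr1.
have w0 : 0 <= y `^ alpha := powR_ge0 _ _.
have e0 : 0 <= 1 - alpha^-1 by rewrite subr_ge0 invf_le1.
have ai0 : 0 <= alpha^-1 by rewrite invr_ge0 ltW.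
have powR_split (u : R) : 0 < u -> u `^ (1 - alpha^-1) * u `^ alpha^-1 = u.
  by move=> u0; rewrite -powRD ?(gt_eqF u0) ?implybT// subrK powRr1// ltW.
have [wd|dw] := leP (y `^ alpha) delta.
  apply: (@le_trans _ _ delta); last by rewrite lerDl.
  rewrite -[leRHS]powR_split//.
  rewrite ler_wpM2l ?powR_ge0// yE ge0_ler_powR// nnegrE//; exact: ltW.
have wgt0 : 0 < y `^ alpha by exact: lt_trans dw.
apply: (@le_trans _ _ (y `^ alpha)); last by rewrite lerDr ltW.
rewrite -[leRHS]powR_split// -yE.
by rewrite ler_wpM2r// ge0_ler_powR ?nnegrE// ltW.
Qed.

Definition shear_slope (R : realType) (alpha delta : R) : R :=
  delta `^ (1 - alpha^-1) / 2.

(** Let [u = |x_0|], [v = |x_i|] with [i] nonzero, and let [b] be the slope. As [u <= 1] and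
    [alpha <= 2], [u ^+ 2 <= u ^ alpha <= 1 - v ^ alpha]. Hence [b * v <= (delta + v ^ alpha) / 2 <=
    (delta + 1 - u ^+ 2) / 2], and [u + (1 - u ^+ 2) / 2 <= 1]. The last inequality is the reason
    for the factor [1 / 2] in the slope. *)
Lemma lball_shear_le (R : realType) d (alpha delta : R) (x : Rn R d.+1) i :
  1 <= alpha -> alpha <= 2 -> 0 < delta -> lball d.+1 alpha x ->
  `|tnth x ord0 + (if i == ord0 then 0 else shear_slope alpha delta) * tnth x i|
    <= 1 + delta.
Proof.
move=> a1 a2 d0 xball.
have a0 : 0 < alpha by exact: lt_le_trans a1.
have x01 := lball_unit_cube a0 xball ord0.
have [_|i0] := eqVneq i ord0; first by rewrite mul0r addr0 (le_trans x01)// lerDl ltW.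
have xi : `|tnth x ord0| `^ alpha + `|tnth x i| `^ alpha <= 1.
  rewrite (le_trans _ xball)// (bigD1 ord0)//= (bigD1 i)//= addrA lerDl.
  by rewrite sumr_ge0.
have x0sqr : `|tnth x ord0| ^+ 2 <= `|tnth x ord0| `^ alpha.
  have [->|x00] := eqVneq `|tnth x ord0| 0; first by rewrite expr0n powR_ge0.
  by rewrite -powR_mulrn// ger_powR// normr_gt0 -normr_eq0 x00.
rewrite /shear_slope (le_trans (ler_normD _ _))// normrM.
rewrite ger0_norm ?divr_ge0 ?powR_ge0//.
have := powR_mul_le_add a1 d0 (normr_ge0 (tnth x i)).
have := normr_ge0 (tnth x ord0).
set u := `|tnth x ord0| in x01 x0sqr xi *; set v := `|tnth x i| in xi *.
nra.
Qed.

Section test_polynomial.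
Variables (R : realType) (d N : nat) (b s y : R).

Definition shear_form (i : 'I_d.+1) : mpoly d.+1 R :=
  s *: (mpolyX R (mnm1 ord0) + (if i == ord0 then 0 else b) *: mpolyX R (mnm1 i)).

(** The squares make fourth powers of the kernel appear in the square of this polynomial, as
    [cheb_kernel_bump] requires; the scalar normalizes the value to 1 where all forms equal [y]. *)
Definition test_poly : mpoly d.+1 R :=
  \prod_(i < d.+1) ((cheb_kernel N y y)^-1 *:
    cheb_kernel N (shear_form i) (mpolyC d.+1 y)) ^+ 2.

Lemma polys_le_test_poly : polys_le (N * (2 * d.+1)) test_poly.
Proof.
rewrite mulnA mulnC; apply: polys_le_prod => i; rewrite muln2 -addnn expr2.
have qN : polys_le N (cheb_kernel N (shear_form i) (mpolyC d.+1 y)).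
  apply: polys_le_cheb_kernel; apply: polys_leZ.
  by apply: polys_leD; [exact: polys_leX|apply: polys_leZ; exact: polys_leX].
by apply: polys_leM; apply: polys_leZ.
Qed.

Lemma peval_test_poly (x : Rn R d.+1) : peval test_poly x =
  \prod_(i < d.+1) (cheb_kernel N
    (s * (tnth x ord0 + (if i == ord0 then 0 else b) * tnth x i)) y /
    cheb_kernel N y y) ^+ 2.
Proof.
rewrite /peval /test_poly rmorph_prod; apply: eq_bigr => i _.
rewrite rmorphXn/= mevalZ (rmorph_cheb_kernel (meval (tnth x)))/= mevalC.
by rewrite mevalZ mevalD mevalZ !mevalXU mulrC.
Qed.

End test_polynomial.

(* The constant of [cheb_kernel_bump] with [a = 4], since
   [1 - y ^+ 2 <= 4 * delta] at [y = (1 - delta) / (1 + delta)]. *)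
Definition bump_const (R : realType) (c : R) : R :=
  (64 / 7) ^+ 4 * (32 + 9 * (4 / c + 2 * 4) ^+ 2).

Lemma inner_test_poly_le (R : realType) d (alpha delta c : R) (N : nat) :
  1 <= alpha -> alpha <= 2 -> 0 < delta -> 0 < c ->
  c <= Num.sqrt delta * N.+1%:R -> delta < 1 ->
  let f := test_poly d N (shear_slope alpha delta) (1 + delta)^-1
    ((1 - delta) / (1 + delta)) in
  inner (lball d.+1 alpha) f f <=
    (bump_const c * (2 * pi * (Num.sqrt delta / N.+1%:R))) ^+ d.+1 *
    (shear_slope alpha delta)^-1 ^+ d :> R.
Proof.
move=> a1 a2 d0 c0 cM d1 /=.
set b := shear_slope alpha delta; set h := Num.sqrt delta / N.+1%:R.
set K := bump_const c; set s := (1 + delta)^-1; set y := (1 - delta) / (1 + delta).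
set f := test_poly d N b s y.
have b0 : 0 < b by rewrite divr_gt0// powR_gt0.
have r0 : 0 < Num.sqrt delta by rewrite sqrtr_gt0.
have h0 : 0 < h by rewrite divr_gt0.
have K0 : 0 <= K by rewrite mulr_ge0// addr_ge0// mulr_ge0// sqr_ge0.
have s0 : 0 < s by rewrite invr_gt0 addr_gt0.
have al0 : 0 < alpha by exact: lt_le_trans a1.
pose g := @affine_bumps R d (- (y / h)) (s / h) (b * s / h).
have g0 t : 0 <= g t by exact: affine_bumps_ge0.
have mg : measurable_fun setT g by exact: measurable_affine_bumps.
(* On the ball all forms lie in [[-1, 1]] by [lball_shear_le], so [cheb_kernel_bump] applies to each
   factor, with [r = Num.sqrt delta] and [a = 4]. *)
have fg t : lball d.+1 alpha t -> peval f t * peval f t <= K ^+ d.+1 * g t.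
  move=> tball; rewrite -expr2 peval_test_poly -prodrXl.
  rewrite -[K ^+ _](_ : \prod_(i < d.+1) K = _); last by rewrite prodr_const card_ord.
  rewrite -big_split /=; apply: ler_prod => i _; rewrite sqr_ge0 /=.
  set z := s * (_ + _).
  rewrite (_ : - (y / h) + _ + _ = (z - y) / h); last first.
    by rewrite /z; case: ifP => _; field; rewrite gt_eqF.
  rewrite -exprM; apply: cheb_kernel_bump => //.
  - have := lball_shear_le i a1 a2 d0 tball; rewrite -/b => zle.
    rewrite -[_ ^+ 2]real_normK ?num_real// expr_le1// normrM gtr0_norm//.
    by rewrite mulrC ler_pdivrMr ?mul1r// addr_gt0.
  - rewrite expr_le1//; last by rewrite divr_ge0// ?subr_ge0 ?addr_ge0// ltW.
    by rewrite ler_pdivrMr ?addr_gt0//; lra.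
  rewrite sqr_sqrtr ?(ltW d0)// /y expr_div_n.
  rewrite -subr_ge0.
  have -> : 4 * delta - (1 - (1 - delta) ^+ 2 / (1 + delta) ^+ 2) =
      4 * delta * ((1 + delta) ^+ 2 - 1) / (1 + delta) ^+ 2.
    by field; rewrite gt_eqF// addr_gt0.
  by rewrite divr_ge0 ?sqr_ge0// mulr_ge0 ?mulr_ge0 ?(ltW d0)//; nra.
have intg : (\int[lebesgue_Rn R d.+1]_(t in lball d.+1 alpha) (peval f t * peval f t)%:E
   <= (K ^+ d.+1 * (pi / (s / h) * (pi / (b * s / h)) ^+ d))%:E)%E.
  apply: (@le_trans _ _ (\int[lebesgue_Rn R d.+1]_(t in lball d.+1 alpha)
      ((K ^+ d.+1)%:E * (g t)%:E))%E).
    apply: ge0_le_integral => //.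
    - exact: measurable_lball.
    - by move=> t _; rewrite lee_fin -expr2 sqr_ge0.
    - apply/measurable_EFinP; apply: measurable_funTS.
      by apply: measurable_funM; exact: measurable_peval.
    - by apply: measurable_funTS; apply: measurable_funeM; apply/measurable_EFinP.
  apply: (@le_trans _ _ (\int[lebesgue_Rn R d.+1]_t ((K ^+ d.+1)%:E * (g t)%:E))%E).
    apply: ge0_subset_integral => //.
    - exact: measurable_lball.
    - by apply: measurable_funeM; apply/measurable_EFinP.
    - by move=> t _; rewrite mule_ge0// lee_fin ?exprn_ge0.
  rewrite ge0_integralZl//; last 3 first.
  - by apply/measurable_EFinP.
  - by move=> t _; rewrite lee_fin.
  - by rewrite lee_fin exprn_ge0.
  rewrite EFinM lee_wpmul2l ?lee_fin ?exprn_ge0//.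
  apply: integral_affine_bumps_le; first exact: divr_gt0.
  exact: divr_gt0 (mulr_gt0 b0 s0) h0.
rewrite /inner /Rintegral.
apply: (@le_trans _ _ (K ^+ d.+1 * (pi / (s / h) * (pi / (b * s / h)) ^+ d))).
  rewrite -lee_fin fineK//.
  rewrite ge0_fin_numE; last first.
    by apply: integral_ge0 => t _; rewrite lee_fin -expr2 sqr_ge0.
  by rewrite (le_lt_trans intg)// ltry.
(* Each of the [d.+1] integrals yields a factor [1 + delta], at most 2 since [delta < 1]; this is
   the 2 in [2 * pi]. *)
have -> : pi / (s / h) = pi * h * (1 + delta).
  by rewrite /s; field; rewrite !gt_eqF ?addr_gt0.
have -> : pi / (b * s / h) = pi * h * (1 + delta) * b^-1.
  by rewrite /s; field; rewrite !gt_eqF ?addr_gt0.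
rewrite [leRHS](_ : _ = K ^+ d.+1 * ((2 * pi * h) ^+ d.+1 * b^-1 ^+ d)); last first.
  by rewrite exprMn mulrA.
rewrite ler_wpM2l ?exprn_ge0//.
rewrite [(_ * b^-1) ^+ d]exprMn mulrA -exprS ler_wpM2r//.
  by rewrite exprn_ge0// invr_ge0 ltW.
have ph0 : 0 <= pi * h by rewrite mulr_ge0 ?pi_ge0// ltW.
have -> : 2 * pi * h = pi * h * 2 by ring.
apply: lerXn2r; rewrite ?nnegrE.
- by rewrite mulr_ge0// addr_ge0// ltW.
- by rewrite mulr_ge0.
- by rewrite ler_wpM2l//; lra.
Qed.

Theorem corollary3p2 (R : realType) (d : nat) (alpha sigma : R)
    (d_gt0 : (0 < d)%N) (alpha_ge1 : 1 <= alpha) (alpha_le2 : alpha <= 2)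
    (sigma_gt0 : 0 < sigma) :
  exists2 c : R, 0 < c &
    forall (n : nat) (delta : R), (0 < n)%N ->
      sigma * n%:R ^- 2 < delta -> delta < 1 ->
      christoffel n (lball d alpha) (axis_point d (1 - delta))
        <= c * n%:R ^- d * delta `^ gamma_exponent alpha d.
Proof.
case: d d_gt0 => // d _.
have alpha_gt0 : 0 < alpha by exact: lt_le_trans alpha_ge1.
pose D : R := 2 * d.+1%:R.
have D0 : 0 < D by rewrite mulr_gt0// ltr0n.
(* From [sigma / n ^+ 2 < delta] and [n <= D * N.+1] it follows that [Num.sqrt delta * N.+1 >= c0];
   [sigma] enters the constant only here. *)
pose c0 := Num.sqrt sigma / D.
have c00 : 0 < c0 by rewrite divr_gt0// sqrtr_gt0.
pose K := bump_const c0.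
have K0 : 0 < K.
  by rewrite mulr_gt0// ltr_pwDl// mulr_ge0// sqr_ge0.
(* Per coordinate, [K] comes from the bump, [2 * pi] from its integral and [D] from passing from
   [N.+1] to [n]; [2 ^+ d] comes from the halves in the slopes. *)
exists ((K * (2 * pi) * D) ^+ d.+1 * 2 ^+ d).
  by rewrite mulr_gt0// exprn_gt0// mulr_gt0// mulr_gt0// mulr_gt0// pi_gt0.
move=> n delta n0 sdelta delta1.
have n0R : 0 < n%:R :> R by rewrite ltr0n.
have delta0 : 0 < delta by rewrite (lt_trans _ sdelta)// divr_gt0 ?exprn_gt0.
(* The largest [N] for which [polys_le_test_poly] gives degree at most [n]. It may be 0, so the
   scale is measured by [N.+1]. *)
pose N := (n %/ (2 * d.+1))%N.
have nDN : n%:R <= D * N.+1%:R.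
  rewrite /D -!natrM ler_nat mulnC ltnW// -ltn_divLR//.
have r0 : 0 < Num.sqrt delta by rewrite sqrtr_gt0.
have sqrt_sigma : Num.sqrt sigma <= Num.sqrt delta * n%:R.
  rewrite -ler_pdivrMr// -[n%:R]gtr0_norm// -sqrtr_sqr -sqrtrV ?sqr_ge0//.
  by rewrite -(sqrtrM _ (ltW sigma_gt0)); apply: ler_wsqrtr; exact: ltW.
have c0N : c0 <= Num.sqrt delta * N.+1%:R.
  rewrite /c0 ler_pdivrMr// (le_trans sqrt_sigma)// -mulrA ler_pM2l//.
  by rewrite mulrC.
pose y := (1 - delta) / (1 + delta).
pose f := test_poly d N (shear_slope alpha delta) (1 + delta)^-1 y.
have fx : peval f (axis_point d.+1 (1 - delta)) = 1.
  rewrite peval_test_poly big1// => i _.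
  rewrite !tnth_mktuple /=.
  rewrite (_ : _ * (_ + _) = y); last first.
    rewrite /y; case: eqVneq => [->|i0]; first by rewrite mul0r addr0 mulrC.
    by move: i0; rewrite -val_eqE /= => /negPf ->; rewrite mulr0 addr0 mulrC.
  by rewrite divff ?expr1n// gt_eqF// (lt_le_trans _ (cheb_kernel_diag_ge N y))//.
have fn : polys_le n f.
  by apply: polys_le_leq (polys_le_test_poly _ _ _ _ _); rewrite leq_divM.
apply: (le_trans (christoffel_le (measurable_lball _)
  (lball_unit_cube alpha_gt0) fn fx)).
apply: (le_trans (inner_test_poly_le d alpha_ge1 alpha_le2 delta0 c00 c0N delta1)).
rewrite -/K; set h := _ / N.+1%:R.
have hD : h <= D * (Num.sqrt delta / n%:R).
  by rewrite mulrCA ler_pM2l// ler_pdivlMr// mulrC ler_pdivrMr ?ltr0n.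
have powE (u v w : R) : delta `^ u * delta `^ v = delta `^ (u + v).
  by rewrite -powRD// (gt_eqF delta0) implybT.
have slopeE : (shear_slope alpha delta)^-1 ^+ d =
    2 ^+ d * delta `^ (- (1 - alpha^-1) * d%:R).
  rewrite /shear_slope invf_div exprMn exprVn mulNr powRN powRrM.
  by rewrite powR_mulrn// powR_ge0.
have sqrtE : Num.sqrt delta ^+ d.+1 = delta `^ (2^-1 * d.+1%:R).
  by rewrite -powR12_sqrt ?ltW// powRrM powR_mulrn// powR_ge0.
(* The exponent splits into [(d + 1) / 2], from the widths [h], and [- (1 - 1 / alpha) * d], from
   the inverse slopes, where the dimension is [d + 1]. *)
have -> : gamma_exponent alpha d.+1 = 2^-1 * d.+1%:R + - (1 - alpha^-1) * d%:R.
  by rewrite /gamma_exponent -natr1; field; rewrite gt_eqF.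
rewrite -powE// -sqrtE slopeE.
have regroup (k e r z w t : R) m :
    (k * e) ^+ m * t / z ^+ m * (r ^+ m * w) = (k * (e * (r / z))) ^+ m * (t * w).
  by rewrite !exprMn exprVn; ring.
have w0 : 0 <= 2 ^+ d * delta `^ (- (1 - alpha^-1) * d%:R).
  by rewrite mulr_ge0 ?powR_ge0 ?exprn_ge0.
rewrite regroup; apply: ler_wpM2r => //.
have h0 : 0 <= h by rewrite divr_ge0// ltW.
have Kpi0 : 0 <= K * (2 * pi).
  by apply: mulr_ge0; [exact: ltW|rewrite mulr_ge0// pi_ge0].
rewrite (mulrA K); apply: lerXn2r; rewrite ?nnegrE.
- exact: mulr_ge0.
- by rewrite mulr_ge0// mulr_ge0 ?divr_ge0 ?(ltW D0) ?(ltW r0).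
- exact: ler_wpM2l.
Qed.
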